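(* Let $G$ be a tree, let $\mathbb{K}$ be a field, let $R=\mathbb{K}[x: x\in V(G)]$, and let $I_3(G)$ be the $3$-path ideal of $G$. Then $$\operatorname{reg}(R/I_3(G))=2\nu_3(G).$$
   Context: All graphs are finite and simple. A tree is a graph containing no cycle. A $3$-path in $G$ is a sequence of three distinct vertices $x_1,x_2,x_3$ with $\{x_1,x_2\},\{x_2,x_3\}\in E(G)$. The $3$-path ideal is $I_3(G)=\langle x_1x_2x_3 : x_1,x_2,x_3 \text{ is a } 3\text{-path in } G\rangle\subseteq R$. A $3$-path matching of $G$ is a subgraph consisting of pairwise vertex-disjoint $3$-paths; it is a $3$-path induced matching if this subgraph is an induced subgraph of $G$ (i.e. the induced subgraph of $G$ on the union of the vertex sets of the paths has no edges other than the edges of the paths). The $3$-path induced matching number $\nu_3(G)$ is the largest number of paths in a $3$-path induced matching of $G$. For a finitely generated graded $R$-module $M$, $\operatorname{reg}(M)=\max\{j-i : \operatorname{Tor}_i^R(M,\mathbb{K})_j\neq 0\}$. *)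

(* Defs.v *)
From mathcomp Require Import all_boot all_order all_algebra.
From mathcomp Require Import mpoly.
Set Implicit Arguments. Unset Strict Implicit. Unset Printing Implicit Defensive.
Import GRing.Theory.
Local Open Scope ring_scope.

Definition simple_graph (n : nat) (e : rel 'I_n) : Prop :=
  ssrbool.symmetric e /\ ssrbool.irreflexive e.

Definition has_cycle (n : nat) (e : rel 'I_n) : Prop :=
  exists s : seq 'I_n, [/\ (3 <= size s)%N, uniq s & cycle e s].

(* "A tree is a graph containing no cycle." *)
Definition is_tree (n : nat) (e : rel 'I_n) : Prop :=
  simple_graph e /\ ~ has_cycle e.

Definition is3path (n : nat) (e : rel 'I_n) (t : 'I_n * 'I_n * 'I_n) : bool :=
  let: (a, b, c) := t in
  [&& a != b, b != c, a != c, e a b & e b c].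

Definition tverts (n : nat) (t : 'I_n * 'I_n * 'I_n) : {set 'I_n} :=
  let: (a, b, c) := t in [set a; b; c].

Definition path_edge (n : nat) (t : 'I_n * 'I_n * 'I_n) (u v : 'I_n) : bool :=
  let: (a, b, c) := t in
  [|| (u == a) && (v == b), (u == b) && (v == a),
      (u == b) && (v == c) | (u == c) && (v == b)].

Definition ind3match (n : nat) (e : rel 'I_n)
    (S : {set 'I_n * 'I_n * 'I_n}) : bool :=
  [&& [forall t in S, is3path e t],
      [forall t in S, forall t' in S,
         (t != t') ==> [disjoint tverts t & tverts t']] &
      [forall u, forall v,
         [&& u \in \bigcup_(t in S) tverts t,
             v \in \bigcup_(t in S) tverts t & e u v] ==>
         [exists t in S, path_edge t u v]]].

Definition nu3 (n : nat) (e : rel 'I_n) : nat :=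
  \max_(S : {set 'I_n * 'I_n * 'I_n} | ind3match e S) #|S|.

Definition mon3 (K : fieldType) (n : nat) (t : 'I_n * 'I_n * 'I_n)
    : {mpoly K[n]} :=
  let: (a, b, c) := t in 'X_a * 'X_b * 'X_c.

Definition in_I3 (K : fieldType) (n : nat) (e : rel 'I_n) (p : {mpoly K[n]})
    : Prop :=
  exists q : 'I_n * 'I_n * 'I_n -> {mpoly K[n]},
    p = \sum_(t | is3path e t) q t * mon3 K t.

Definition homog_int (K : fieldType) (n : nat) (p : {mpoly K[n]}) (z : int)
    : bool :=
  match z with
  | Posz m => p \is m.-homog
  | Negz _ => p == 0
  end.

(* A graded free resolution  ... -> F_2 -> F_1 -> F_0 -> R/I -> 0, where
   F_i = (+)_{k < r i} R(-sh i k), elements of F_i are row vectors,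
   d i : F_(i+1) -> F_i is (right multiplication by) a matrix, and
   eps : F_0 -> R/I sends the k-th basis vector to the class of eps k 0. *)
Record gfres (K : fieldType) (n : nat) := GFRes {
  rk  : nat -> nat;
  sh  : forall i, 'I_(rk i) -> int;
  dif : forall i, 'M[{mpoly K[n]}]_(rk i.+1, rk i);
  eps : 'cV[{mpoly K[n]}]_(rk 0)
}.
Arguments rk {K n} F i : rename.
Arguments sh {K n} F i k : rename.
Arguments dif {K n} F i : rename.
Arguments eps {K n} F : rename.

Definition is_gfres_quot (K : fieldType) (n : nat)
    (I : {mpoly K[n]} -> Prop) (F : gfres K n) : Prop :=
  [/\
      (forall k, homog_int (eps F k 0) (sh F 0 k)),
      (forall i k l, homog_int (dif F i k l) (sh F i.+1 k - sh F i l)),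
      (forall p : {mpoly K[n]}, exists v : 'rV_(rk F 0),
          I (p - (v *m eps F) 0 0)),
      (forall v : 'rV_(rk F 0),
          I ((v *m eps F) 0 0) <-> exists w, v = w *m dif F 0) &
      (forall i (v : 'rV_(rk F i.+1)),
          v *m dif F i = 0 <-> exists w, v = w *m dif F i.+1)].

(* F (x)_R K, with K = R/(x_1..x_n): matrices of constant terms. *)
Definition cst_mx (K : fieldType) (n : nat) a b
    (M : 'M[{mpoly K[n]}]_(a, b)) : 'M[K]_(a, b) :=
  \matrix_(k, l) (M k l)@_0%MM.

(* Boundary map of F (x) K out of homological degree i (zero for i = 0),
   into degree i.-1. *)
Definition cycle_cond (K : fieldType) (n : nat) (F : gfres K n) (i : nat)
    : 'rV[K]_(rk F i) -> Prop :=
  match i return 'rV[K]_(rk F i) -> Prop with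
  | 0 => fun _ => True
  | m.+1 => fun v => v *m cst_mx (dif F m) = 0
  end.

(* Tor_i^R(R/I, K)_j <> 0, computed as the degree-j homology at position i
   of the complex F (x)_R K. *)
Definition Tor_nonzero (K : fieldType) (n : nat) (F : gfres K n)
    (i : nat) (j : int) : Prop :=
  exists v : 'rV[K]_(rk F i),
    [/\ forall k, sh F i k != j -> v 0 k = 0,
        cycle_cond v &
        ~ exists w : 'rV[K]_(rk F i.+1),
            (forall k, sh F i.+1 k != j -> w 0 k = 0) /\
            v = w *m cst_mx (dif F i)].

Definition reg_eq (K : fieldType) (n : nat) (I : {mpoly K[n]} -> Prop)
    (r : int) : Prop :=
  (exists F : gfres K n, is_gfres_quot I F) /\
  forall F : gfres K n, is_gfres_quot I F ->
    (exists i j, Tor_nonzero F i j /\ j - i%:Z = r) /\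
    (forall i j, Tor_nonzero F i j -> j - i%:Z <= r).

(* Main.v *)
From HB Require Import structures.
Require Import Defs.
From mathcomp Require Import all_boot all_order all_algebra.
From mathcomp Require Import mpoly.
From mathcomp Require Import zify ring.
From Stdlib Require Import IndefiniteDescription.
Set Implicit Arguments. Unset Strict Implicit. Unset Printing Implicit Defensive.
Import Order.TTheory GRing.Theory Num.Theory.
Local Open Scope ring_scope.

(* Upper bound.  Let a be a leaf of the forest G with neighbour b.  Adding to
   I_3(G - a) the monomials a b x, for x running over the other neighbours of
   b, gives I_3(G), and each colon ideal met on the way, by a b x, is generated
   by the remaining neighbours of b and x together with I_3(G'), where
   G' = G - N[b] - N[x].  The path a b x can be added to any induced matching
   of G', so nu_3(G') < nu_3(G), and by induction every mapping cone of
   R/(I : m)(-3) -> R/I has its shifts in homological degree i bounded by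
   i + 2 nu_3(G).  Comparing with this resolution bounds the Tor of any other.

   Lower bound.  Let J be the complete intersection generated by the path
   monomials of a maximum induced matching, and J' = J + (all the variables
   outside it), so that J <= I_3(G) <= J'.  The inclusion of the Koszul complex
   of J into that of J' factors, up to homotopy, through any resolution F of
   R/I_3(G); as both complexes are minimal, the top generator of the first, of
   degree 3 nu in homological degree nu, survives in Tor(F). *)

(** Builds the chain maps and homotopies below one degree at a time, the sizes of their matrices
    varying with the degree. [Q] is the invariant that makes the next step possible. *)
Lemma dependent_choice_from (X : nat -> Type) (Q : forall i, X i -> Prop)
    (S : forall i, X i -> X i.+1 -> Prop) (x0 : X 0) :
  Q 0 x0 -> (forall i x, Q i x -> exists y, Q i.+1 y /\ S i x y) ->
  exists f : forall i, X i,
    [/\ f 0 = x0, forall i, Q i (f i) & forall i, S i (f i) (f i.+1)].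
Proof.
move=> Q0 step.
pose next i (u : {x : X i | Q i x}) : {y : X i.+1 | Q i.+1 y /\ S i (sval u) y} :=
  constructive_indefinite_description _ (step i (sval u) (svalP u)).
pose F := fix F i : {x : X i | Q i x} :=
  match i with
  | 0 => exist _ x0 Q0
  | j.+1 => let v := next j (F j) in exist _ (sval v) (proj1 (svalP v))
  end.
exists (fun i => sval (F i)); split=> // i; first exact: svalP (F i).
exact: proj2 (svalP (next i (F i))).
Qed.

(** * Homogeneous components, with integer degrees *)

Section Homogeneous.
Context (K : fieldType) (n : nat).
Implicit Types (p q : {mpoly K[n]}) (z w : int).

(** Negative degrees get the component 0, as in [homog_int], so differences of shifts serve as
    degrees without sign conditions. *)
Definition hcomp z p : {mpoly K[n]} :=
  if z is Posz d then pihomog mdeg d p else 0.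

Lemma hcomp_is_zmod_morphism z : zmod_morphism (hcomp z).
Proof. by case: z => d p q /=; rewrite ?raddfB ?subr0. Qed.

HB.instance Definition _ z :=
  GRing.isZmodMorphism.Build {mpoly K[n]} {mpoly K[n]} (hcomp z)
    (hcomp_is_zmod_morphism z).

Lemma homog_int0 z : homog_int (0 : {mpoly K[n]}) z.
Proof. by case: z => d //=; apply: rpred0. Qed.

Lemma homog_intN z p : homog_int p z -> homog_int (- p) z.
Proof. by case: z => d /=; rewrite ?rpredN ?oppr_eq0. Qed.

Lemma homog_int1 : homog_int (1 : {mpoly K[n]}) 0.
Proof. exact: dhomog1. Qed.

Lemma homog_intM z w p q :
  homog_int p z -> homog_int q w -> homog_int (p * q) (z + w).
Proof.
case: z => z; last by move/eqP->; rewrite mul0r => _; apply: homog_int0.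
case: w => w; last by move=> _ /eqP->; rewrite mulr0; apply: homog_int0.
exact: dhomogM.
Qed.

Lemma homog_hcomp z p : homog_int (hcomp z p) z.
Proof. by case: z => d //=; apply: pihomogP. Qed.

Lemma hcomp_homog z w p :
  homog_int p w -> hcomp z p = if z == w then p else 0.
Proof.
case: w => w /=; last by move/eqP->; rewrite raddf0 if_same.
move=> hp; case: z => d //=; case: eqVneq => [[->]|ne]; first exact: pihomog_dE.
by apply: (@pihomog_ne0 _ _ _ w) => //; apply: contraNneq ne => ->.
Qed.

Lemma hcompMr z w p q :
  homog_int q w -> hcomp z (p * q) = hcomp (z - w) p * q.
Proof.
move=> hq; rewrite [p]mpolyE mulr_suml !raddf_sum /= mulr_suml.
apply: eq_bigr => m _; set t := p@_m *: 'X_[m].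
have ht : homog_int t (mdeg m) by apply: dhomogZ; rewrite dhomogX.
rewrite (hcomp_homog _ (homog_intM ht hq)) (hcomp_homog _ ht) subr_eq.
by case: eqP; rewrite ?mul0r.
Qed.

Lemma homog_int_cst z p : homog_int p z -> z != 0 -> p@_0%MM = 0.
Proof.
case: z => d /=; last by move/eqP->; rewrite mcoeff0.
by move=> hp nz; apply: (dhomog_nemf_coeff hp); rewrite mf0 eq_sym.
Qed.

Lemma msupp_hcomp z p : {subset msupp (hcomp z p) <= msupp p}.
Proof.
case: z => d m /=; last by rewrite msupp0.
rewrite mcoeff_msupp; apply: contraR => hm.
rewrite pihomogE raddf_sum /= big_seq_cond big1 // => k /andP[hk _].
rewrite mcoeffZ mcoeffX; case: eqP hk => [->|_ _]; last by rewrite mulr0.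
by rewrite (negPf hm).
Qed.

End Homogeneous.

Section Matrices.
Context (R : comNzRingType).

Lemma mulmx_eq_rows (a b : nat) (A B : 'M[R]_(a, b)) :
  (forall v : 'rV_a, v *m A = v *m B) -> A = B.
Proof. by move=> AB; apply/row_matrixP => i; rewrite !rowE AB. Qed.

Lemma factor_rows (a b c : nat) (M : 'M[R]_(a, c)) (D : 'M[R]_(b, c)) :
  (forall k, exists w : 'rV_b, row k M = w *m D) -> exists N, M = N *m D.
Proof.
move=> /fin_all_exists[w hw]; exists (\matrix_k w k).
by apply/row_matrixP => k; rewrite row_mul rowK.
Qed.

End Matrices.

(** * Comparison of graded free resolutions and upper bounds for Tor *)

Section Resolutions.
Context (K : fieldType) (n : nat).
Local Notation P := {mpoly K[n]}.
Implicit Types (I J : P -> Prop) (F T : gfres K n).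

Definition hideal I : Prop :=
  [/\ I 0, forall p q, I p -> I q -> I (p + q), forall a p, I p -> I (a * p)
    & forall z p, I p -> I (hcomp z p)].

(** With [s] and [t] the degrees of the basis vectors, these are the degree-preserving maps of
    graded free modules, acting on row vectors. *)
Definition homog_mx (a b : nat) (s : 'I_a -> int) (t : 'I_b -> int)
    (M : 'M[P]_(a, b)) : Prop :=
  forall k l, homog_int (M k l) (s k - t l).

Lemma hidealN I p : hideal I -> I p -> I (- p).
Proof. by case=> _ _ hM _ hp; rewrite -mulN1r; apply: hM. Qed.

Lemma hidealB I p q : hideal I -> I p -> I q -> I (p - q).
Proof. by move=> hI hp hq; have [_ hD _ _] := hI; apply: (hD) => //; apply: hidealN. Qed.

Lemma hideal_sum I (A : finType) (f : A -> P) :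
  hideal I -> (forall a, I (f a)) -> I (\sum_a f a).
Proof. by case=> h0 hD _ _ hf; apply: big_ind => // a _; apply: hf. Qed.

Lemma hideal_mulmx I (a b c : nat) (M : 'M[P]_(a, b)) (N : 'M[P]_(b, c)) :
  hideal I -> (forall k l, I (N k l)) -> forall k l, I ((M *m N) k l).
Proof.
move=> hI hN k l; rewrite mxE; apply: hideal_sum => // j.
by have [_ _ hM _] := hI; apply: hM.
Qed.

Lemma homog_mulmx (a b c : nat) (s : 'I_a -> int) (t : 'I_b -> int)
    (u : 'I_c -> int) (M : 'M[P]_(a, b)) (N : 'M[P]_(b, c)) :
  homog_mx s t M -> homog_mx t u N -> homog_mx s u (M *m N).
Proof.
move=> hM hN k l; rewrite mxE.
elim/big_ind: _ => [|p q|j _]; first exact: homog_int0.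
  case: (s k - u l) => d /=; first exact: rpredD.
  by move=> /eqP-> /eqP->; rewrite addr0.
by rewrite -(subrK (t j) (s k)) -addrA; apply: homog_intM.
Qed.

Definition hcomp_mx (a b : nat) (s : 'I_a -> int) (t : 'I_b -> int)
    (M : 'M[P]_(a, b)) := \matrix_(k, l) hcomp (s k - t l) (M k l).

Lemma homog_hcomp_mx (a b : nat) (s : 'I_a -> int) (t : 'I_b -> int) M :
  homog_mx s t (hcomp_mx s t M).
Proof. by move=> k l; rewrite mxE; apply: homog_hcomp. Qed.

Lemma hcomp_mx_mul (a b c : nat) (s : 'I_a -> int) (t : 'I_b -> int)
    (u : 'I_c -> int) (M : 'M[P]_(a, b)) (N : 'M[P]_(b, c)) :
  homog_mx t u N -> hcomp_mx s u (M *m N) = hcomp_mx s t M *m N.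
Proof.
move=> hN; apply/matrixP => k l; rewrite !mxE raddf_sum; apply: eq_bigr => j _.
rewrite /= (hcompMr _ _ (hN j l)) mxE; congr (hcomp _ _ * _); lia.
Qed.

Lemma hcomp_mx_homog (a b : nat) (s : 'I_a -> int) (t : 'I_b -> int) M :
  homog_mx s t M -> hcomp_mx s t M = M.
Proof.
by move=> hM; apply/matrixP => k l; rewrite mxE (hcomp_homog _ (hM k l)) eqxx.
Qed.

Section Resolution.
Context (I : P -> Prop) (F : gfres K n) (resF : is_gfres_quot I F).

Lemma homog_eps k : homog_int (eps F k 0) (sh F 0 k).
Proof. by case: resF. Qed.

Lemma homog_dif i : homog_mx (@sh _ _ F i.+1) (@sh _ _ F i) (dif F i).
Proof. by case: resF => _ h _ _ _; apply: h. Qed.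

Lemma difK i : dif F i.+1 *m dif F i = 0.
Proof.
case: resF => _ _ _ _ h; apply: mulmx_eq_rows => v.
by rewrite mulmxA mulmx0; apply/h; exists v.
Qed.

Lemma dif_eps k : I ((dif F 0 *m eps F) k 0).
Proof.
case: resF => _ _ _ h _; have /h : exists w, row k (dif F 0) = w *m dif F 0.
  by exists (delta_mx 0 k); rewrite -rowE.
by rewrite -row_mul mxE.
Qed.

Lemma lift_dif a i (M : 'M_(a, _)) :
  M *m dif F i = 0 -> exists N, M = N *m dif F i.+1.
Proof.
case: resF => _ _ _ _ h M0; apply: factor_rows => k.
by apply/h; rewrite -row_mul M0 row0.
Qed.

Lemma lift_dif0 a (M : 'M_(a, _)) :
  (forall k, I ((M *m eps F) k 0)) -> exists N, M = N *m dif F 0.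
Proof.
case: resF => _ _ _ h _ M0; apply: factor_rows => k.
by apply/h; rewrite -row_mul mxE.
Qed.

Lemma lift_eps a (M : 'cV[P]_a) :
  exists N, forall k, I (M k 0 - (N *m eps F) k 0).
Proof.
case: resF => _ _ h _ _.
have /fin_all_exists[w hw] : forall k,
    exists v : 'rV_(rk F 0), I (M k 0 - (v *m eps F) 0 0).
  by move=> k; apply: h.
exists (\matrix_k w k) => k; have := hw k.
by rewrite -[X in (X *m _) 0 0](rowK w) -row_mul mxE.
Qed.

End Resolution.

(** Multiplying by the homogeneous [D] commutes with taking degree-preserving parts, so that part of
    [N] is still a factor. *)
Lemma homog_factor (a b c : nat) (s : 'I_a -> int) (t : 'I_b -> int)
    (u : 'I_c -> int) (M : 'M[P]_(a, c)) (D : 'M[P]_(b, c)) N :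
  homog_mx s u M -> homog_mx t u D -> M = N *m D ->
  exists2 N', homog_mx s t N' & M = N' *m D.
Proof.
move=> hM hD MND; exists (hcomp_mx s t N); first exact: homog_hcomp_mx.
by rewrite -(hcomp_mx_mul s N hD) -MND hcomp_mx_homog.
Qed.

Definition chain_map F T (f : forall i, 'M[P]_(rk F i, rk T i)) : Prop :=
  forall i, dif F i *m f i = f i.+1 *m dif T i.

(** Multiplication by [a] is a map R/I(-d) -> R/J, which exactness of [T] lifts degree by degree. It
    serves with [a = 1] to compare resolutions and with a monomial to form mapping cones. *)
Lemma lift_chain I J F T (a : P) (d : int) :
  hideal J -> is_gfres_quot I F -> is_gfres_quot J T ->
  homog_int a d -> (forall p, I p -> J (a * p)) ->
  exists f : forall i, 'M[P]_(rk F i, rk T i),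
    [/\ @chain_map F T f,
        forall k, J (a * eps F k 0 - (f 0 *m eps T) k 0)
      & forall i, homog_mx (fun k => sh F i k + d) (@sh _ _ T i) (f i)].
Proof.
move=> hJ resF resT ha aIJ; have [J0 JD JM Jh] := hJ.
pose s i (k : 'I_(rk F i)) := sh F i k + d.
have [f0 hf0 f0E] : exists2 f0, homog_mx (s 0) (@sh _ _ T 0) f0 &
    forall k, J (a * eps F k 0 - (f0 *m eps T) k 0).
  have [N hN] := lift_eps resT (a *: eps F).
  exists (hcomp_mx (s 0) (@sh _ _ T 0) N); first exact: homog_hcomp_mx.
  have hT : homog_mx (@sh _ _ T 0) (fun _ : 'I_1 => 0) (eps T).
    by move=> k l; rewrite ord1 subr0; apply: (homog_eps resT).
  move=> k; have := Jh (s 0 k) _ (hN k); rewrite raddfB /= mxE.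
  have hk : homog_int (a * eps F k 0) (s 0 k).
    by rewrite /s addrC; apply: homog_intM; rewrite ?(homog_eps resF).
  rewrite (hcomp_homog _ hk) eqxx -(hcomp_mx_mul _ _ hT) [X in _ -> J (_ - X)]mxE.
  by rewrite subr0.
pose Q i (x : 'M[P]_(rk F i, rk T i)) :=
  homog_mx (s i) (@sh _ _ T i) x /\ exists y, dif F i *m x = y *m dif T i.
have Q0 : Q 0 f0.
  split=> //; apply: (lift_dif0 resT) => k; rewrite -mulmxA.
  set E := f0 *m eps T.
  have -> : dif F 0 *m E = dif F 0 *m (E - a *: eps F) + a *: (dif F 0 *m eps F).
    by rewrite mulmxBr -scalemxAr subrK.
  rewrite mxE; apply: JD; last by rewrite mxE; apply/aIJ/(dif_eps resF).
  apply: hideal_mulmx => // j l; rewrite !mxE -opprB ord1; apply: hidealN => //.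
  by have := f0E j; rewrite mxE.
have [|f [f0eq Qf Sf]] := dependent_choice_from
    (S := fun i x y => dif F i *m x = y *m dif T i) Q0.
  move=> i x [hx [y xy]].
  have hdx : homog_mx (s i.+1) (@sh _ _ T i) (dif F i *m x).
    apply: (@homog_mulmx _ _ _ _ (s i)) hx => k l; rewrite /s opprD addrACA subrr addr0.
    exact: (homog_dif resF).
  have [y' hy' xy'] := homog_factor hdx (@homog_dif _ _ resT i) xy.
  exists y'; split=> //; split=> //; apply: (lift_dif resT).
  by rewrite -mulmxA -xy' mulmxA (difK resF) mul0mx.
exists f; split=> // [k|i]; first by rewrite f0eq; apply: f0E.
by case: (Qf i).
Qed.

Lemma null_homotopic I J F T (f : forall i, 'M[P]_(rk F i, rk T i)) :
  is_gfres_quot I F -> is_gfres_quot J T -> @chain_map F T f ->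
  (forall k, J ((f 0 *m eps T) k 0)) ->
  exists h : forall i, 'M[P]_(rk F i, rk T i.+1),
    f 0 = h 0 *m dif T 0 /\
    forall i, f i.+1 = h i.+1 *m dif T i.+1 + dif F i *m h i.
Proof.
move=> resF resT cf f0; have [h0 h0E] := lift_dif0 resT f0.
(* [Q i x] makes the rows of [f i.+1 - dif F i *m x] cycles of [T], which exactness factors through
   [dif T i.+1]. *)
pose Q i (x : 'M[P]_(rk F i, rk T i.+1)) := dif F i *m (f i - x *m dif T i) = 0.
have Q0 : Q 0 h0 by rewrite /Q -h0E subrr mulmx0.
have [|h [hE _ Sh]] := dependent_choice_from
    (S := fun i x y => f i.+1 = y *m dif T i.+1 + dif F i *m x) Q0.
  move=> i x Qx; have [|y yE] := @lift_dif _ _ resT _ i (f i.+1 - dif F i *m x).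
    by rewrite mulmxBl -cf -mulmxA -mulmxBr.
  exists y; rewrite -yE subrK; split=> //.
  by rewrite /Q -yE opprB addrC subrK mulmxA (difK resF) mul0mx.
by exists h; split=> //; rewrite hE.
Qed.

Lemma cst_mxE (a b : nat) (M : 'M[P]_(a, b)) k l : cst_mx M k l = (M k l)@_0%MM.
Proof. by rewrite mxE. Qed.

Lemma cst_mxM (a b c : nat) (M : 'M[P]_(a, b)) (N : 'M[P]_(b, c)) :
  cst_mx (M *m N) = cst_mx M *m cst_mx N.
Proof.
apply/matrixP => k l; rewrite !mxE raddf_sum; apply: eq_bigr => j _.
by rewrite /= rmorphM !mxE.
Qed.

Lemma cst_mxD (a b : nat) (M N : 'M[P]_(a, b)) :
  cst_mx (M + N) = cst_mx M + cst_mx N.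
Proof. by apply/matrixP => k l; rewrite !mxE mcoeffD. Qed.

Lemma cst_mxN (a b : nat) (M : 'M[P]_(a, b)) : cst_mx (- M) = - cst_mx M.
Proof. by apply/matrixP => k l; rewrite !mxE mcoeffN. Qed.

Lemma cst_mx1 (a : nat) : cst_mx (1%:M : 'M[P]_a) = 1%:M.
Proof.
by apply/matrixP => k l; rewrite !mxE; case: eqP; rewrite ?mcoeff0 // mcoeff1 eqxx.
Qed.

Lemma cst_mx_homog (a b : nat) (s : 'I_a -> int) (t : 'I_b -> int) (M : 'M[P]_(a, b)) k l :
  homog_mx s t M -> s k != t l -> cst_mx M k l = 0.
Proof.
by move=> hM ne; rewrite cst_mxE (homog_int_cst (hM k l)) // subr_eq0.
Qed.

Definition shifts_le F (r : int) : Prop := forall i k, sh F i k <= i%:Z + r.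

(* The identity of [F] factors up to homotopy through [T], which has no
   generator in degree [j] when [j - i > r]. *)
Lemma Tor_le I F T (r : int) i j :
  hideal I -> is_gfres_quot I F -> is_gfres_quot I T -> shifts_le T r ->
  Tor_nonzero F i j -> j - i%:Z <= r.
Proof.
move=> hI resF resT Tr [v [vj cv nb]].
rewrite leNgt; apply/negP => lt_r; apply: nb.
have [_ _ hIM _] := hI.
have aI : forall p, I p -> I (1 * p) by move=> p; apply: hIM.
have [g [cg g0 hg]] := lift_chain hI resF resT (homog_int1 K n) aI.
have [f [cf f0 _]] := lift_chain hI resT resF (homog_int1 K n) aI.
(* [g] followed by [f] lifts the identity of R/I, so [u] is null-homotopic. *)
pose u i := g i *m f i - 1%:M.
have cu : @chain_map F F u.
  by move=> m; rewrite mulmxBr mulmxBl mulmxA cg -!mulmxA cf mulmx1 mul1mx.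
have [|h [h0 hS]] := null_homotopic resF resF cu.
  move=> k; rewrite mulmxBl mul1mx -mulmxA.
  have -> : g 0 *m (f 0 *m eps F) - eps F =
     g 0 *m (f 0 *m eps F - eps T) + (g 0 *m eps T - eps F).
    by rewrite mulmxBr addrA subrK.
  have [_ hID _ _] := hI; rewrite mxE; apply: hID.
    apply: hideal_mulmx => // k' l; rewrite ord1.
    by have := hidealN hI (f0 k'); rewrite mul1r opprB !mxE.
  by have := hidealN hI (g0 k); rewrite mul1r opprB !mxE.
(* A homogeneous matrix has nonzero constant entries only between generators of equal degree, and
   [T] has none of degree [j] in position [i]. *)
have vg : v *m cst_mx (g i) = 0.
  apply/rowP => l; rewrite !mxE big1 // => k _.
  have [kj|kj] := eqVneq (sh F i k) j; last by rewrite vj // mul0r.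
  rewrite (cst_mx_homog (hg i)) ?mulr0 //= addr0 kj.
  by apply: contraTneq lt_r => ->; have := Tr i l; rewrite -leNgt; lia.
have vh : - v = (v *m cst_mx (h i)) *m cst_mx (dif F i).
  have uE : v *m cst_mx (u i) = - v.
    by rewrite cst_mxD cst_mxN cst_mx1 cst_mxM mulmxDr mulmxA vg mul0mx mulmxN mulmx1 add0r.
  rewrite -uE; case: i v cv {vj lt_r vg uE} => [|m] v cv /=.
    by rewrite h0 cst_mxM mulmxA.
  by rewrite hS cst_mxD !cst_mxM mulmxDr !mulmxA cv mul0mx addr0.
pose w := - (v *m cst_mx (h i)).
have vw : v = w *m cst_mx (dif F i) by rewrite mulNmx -vh opprK.
(* The homotopy need not be homogeneous, so only the entries of [w] in degree [j] are kept; as the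
   differential preserves degrees, the image is still [v]. *)
exists (\row_k if sh F i.+1 k == j then w 0 k else 0); split=> [k|].
  by rewrite mxE => /negPf->.
apply/rowP => l; rewrite !mxE.
have [lj|lj] := eqVneq (sh F i l) j.
  rewrite vw mxE; apply: eq_bigr => k _; rewrite [in RHS]mxE.
  case: eqVneq => // kj; rewrite (cst_mx_homog (@homog_dif _ _ resF i)) ?mulr0 //.
  by rewrite lj.
rewrite vj // big1 // => k _; rewrite mxE; case: eqVneq => [kj|]; last by rewrite mul0r.
by rewrite (cst_mx_homog (@homog_dif _ _ resF i)) ?mulr0 // kj eq_sym.
Qed.

End Resolutions.

(** * Detecting nonzero Tor between two minimal resolutions *)

Section LowerBound.
Context (K : fieldType) (n : nat).
Local Notation P := {mpoly K[n]}.

Definition minimal_res (T : gfres K n) : Prop := forall i, cst_mx (dif T i) = 0.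

(* [T -> F -> T'] is homotopic to [iota], and homotopies between minimal
   complexes vanish after tensoring with [K]. *)
Lemma Tor_ge (I J J' : P -> Prop) (F T T' : gfres K n)
    (iota : forall i, 'M[P]_(rk T i, rk T' i)) i (k : 'I_(rk T i)) :
  hideal I -> hideal J' ->
  (forall p, J p -> I p) -> (forall p, I p -> J' p) ->
  is_gfres_quot I F -> is_gfres_quot J T -> is_gfres_quot J' T' ->
  minimal_res T -> minimal_res T' ->
  chain_map iota -> eps T = iota 0%N *m eps T' ->
  (forall v : 'rV_(rk T i), v *m cst_mx (iota i) = 0 -> v = 0) ->
  Tor_nonzero F i (sh T i k).
Proof.
move=> hI hJ' JI IJ' resF resT resT' mT mT' ci i0 inj.
have [_ _ hIM _] := hI; have [_ hJD hJM _] := hJ'.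
have aI p : J p -> I (1 * p) by move/JI; apply: hIM.
have aJ p : I p -> J' (1 * p) by move/IJ'; apply: hJM.
have [g [cg g0 hg]] := lift_chain hI resT resF (homog_int1 K n) aI.
have [h [ch h0 _]] := lift_chain hJ' resF resT' (homog_int1 K n) aJ.
pose u i := g i *m h i - iota i.
have cu : chain_map u.
  by move=> m; rewrite mulmxBr mulmxBl mulmxA cg ci -!mulmxA ch.
have [|s [s0 sS]] := null_homotopic resT resT' cu.
  move=> l; rewrite mulmxBl -mulmxA -i0.
  have -> : g 0%N *m (h 0%N *m eps T') - eps T =
     g 0%N *m (h 0%N *m eps T' - eps F) + (g 0%N *m eps F - eps T).
    by rewrite mulmxBr addrA subrK.
  rewrite mxE; apply: hJD.
    apply: hideal_mulmx => // k' l'; rewrite ord1.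
    by have := hidealN hJ' (h0 k'); rewrite mul1r opprB !mxE.
  by have := hidealN hI (g0 l); rewrite mul1r opprB !mxE => /IJ'.
have ghi : cst_mx (g i) *m cst_mx (h i) = cst_mx (iota i).
  apply/eqP; rewrite -cst_mxM -subr_eq0 -cst_mxN -cst_mxD -/(u i).
  case: (i) => [|m]; first by rewrite s0 cst_mxM mT' mulmx0.
  by rewrite sS cst_mxD !cst_mxM mT mT' mulmx0 mul0mx addr0.
(* The class is the image under [g] of the basis vector [k]. If it were a boundary, minimality of
   [T'] would make [h] kill it, against the injectivity of [iota]. *)
exists (delta_mx 0 k *m cst_mx (g i)); split.
- move=> l ne; rewrite -rowE mxE (cst_mx_homog (hg i)) //= addr0.
  by rewrite eq_sym.
- case: i k {inj ghi} => //= m k.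
  by rewrite -mulmxA -cst_mxM -cg cst_mxM mT mul0mx mulmx0.
case=> w [_ vw].
have /inj : (delta_mx 0 k : 'rV_(rk T i)) *m cst_mx (iota i) = 0.
  by rewrite -ghi mulmxA vw -mulmxA -cst_mxM ch cst_mxM mT' !mulmx0.
by move/matrixP/(_ 0 k); rewrite !mxE !eqxx => /eqP; rewrite oner_eq0.
Qed.

End LowerBound.

(** * The mapping cone as a resolution of R/(I + (a)) *)

Section Cone.
Context (K : fieldType) (n : nat).
Local Notation P := {mpoly K[n]}.
Context (A B : gfres K n) (d : int) (f : forall i, 'M[P]_(rk A i, rk B i)).

(** [A] moves up one homological degree, so position 0 has no summand from it. *)
Definition cone_rk i := if i is j.+1 then (rk B j.+1 + rk A j)%N else rk B 0.

Definition cone_sh i : 'I_(cone_rk i) -> int :=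
  match i with
  | 0 => sh B 0
  | j.+1 => fun k => match split k with
                     | inl k' => sh B j.+1 k'
                     | inr k' => sh A j k' + d
                     end
  end.

Definition cone_dif i : 'M[P]_(cone_rk i.+1, cone_rk i) :=
  match i with
  | 0 => col_mx (dif B 0) (f 0)
  | j.+1 => block_mx (dif B j.+1) 0 (f j.+1) (- dif A j)
  end.

Definition cone : gfres K n :=
  @GFRes K n cone_rk cone_sh cone_dif (eps B).

(** A generator of [A] gains [d] in degree and one in homological degree, hence [d - 1]. *)
Lemma shifts_le_cone (r s t : int) :
  shifts_le B r -> shifts_le A s -> r <= t -> s + d - 1 <= t ->
  shifts_le cone t.
Proof.
move=> hB hA rt st [|i] k /=; first by rewrite (le_trans (hB 0 k)) ?lerD2l.
by case: splitP => k' _; [have := hB i.+1 k'|have := hA i k']; rewrite intS; lia.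
Qed.

Context (I I' : P -> Prop) (a : P).
Hypotheses (hI : hideal I) (resB : is_gfres_quot I B) (resA : is_gfres_quot I' A).
Hypothesis colon : forall p, I' p <-> I (a * p).
Hypothesis cf : chain_map f.
Hypothesis f0 : forall k, I (a * eps A k 0 - (f 0 *m eps B) k 0).
Hypothesis hf : forall i, homog_mx (fun k => sh A i k + d) (@sh _ _ B i) (f i).

Let f0v (v : 'rV_(rk A 0)) :
  I (a * (v *m eps A) 0 0 - (v *m f 0 *m eps B) 0 0).
Proof.
have -> : a * (v *m eps A) 0 0 - (v *m f 0 *m eps B) 0 0 =
    (v *m (a *: eps A - f 0 *m eps B)) 0 0.
  by rewrite mulmxBr -mulmxA -scalemxAr !mxE.
apply: hideal_mulmx => // k l; rewrite ord1.
by have := f0 k; rewrite !mxE.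
Qed.

(** By [colon], multiplication by [a] is injective from R/I' to R/I, with cokernel R/(I + (a)); so
    the cone of its lift [f] resolves that cokernel. *)
Lemma cone_res : is_gfres_quot (fun p => exists c, I (p - c * a)) cone.
Proof.
have [I0 ID IM _] := hI.
have mxB (X Y : 'M[P]_1) : (X - Y) 0 0 = X 0 0 - Y 0 0 by rewrite !mxE.
have homA i k l : homog_int (dif A i k l) (sh A i.+1 k - sh A i l) by case: resA.
have homB i k l : homog_int (dif B i k l) (sh B i.+1 k - sh B i l) by case: resB.
split.
- by case: resB.
- case=> [|i] k l /=.
    by rewrite mxE; case: splitP => k' _; [apply: homB|apply: hf].
  rewrite !mxE; case: splitP => k' _; rewrite mxE; case: splitP => l' _.
  + exact: homB.
  + by rewrite mxE; apply: homog_int0.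
  + exact: hf.
  rewrite mxE; apply: homog_intN; rewrite opprD addrACA subrr addr0; exact: homA.
- move=> p; case: resB => _ _ /(_ p)[v hv] _ _; exists v, 0.
  by rewrite mul0r subr0.
- move=> v /=; split=> [[c hc]|[w ->]].
    (* With [c] written as [u *m eps A] modulo [I'], subtracting [u *m f 0] from [v] moves its image
       from I + (a) into [I], where exactness of [B] applies. *)
    case: (resA) => _ _ /(_ c)[u /colon hu] _ _.
    have hvu : I (((v - u *m f 0) *m eps B) 0 0).
      have -> : ((v - u *m f 0) *m eps B) 0 0 =
          ((v *m eps B) 0 0 - c * a) + (a * (c - (u *m eps A) 0 0)
          + (a * (u *m eps A) 0 0 - (u *m f 0 *m eps B) 0 0)).
        by rewrite mulmxBl mxB; ring.
      by apply: (ID) => //; apply: (ID).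
    case: (resB) => _ _ _ /(_ (v - u *m f 0))[/(_ hvu)[w hw] _] _.
    by exists (row_mx w u); rewrite mul_row_col -hw subrK.
  rewrite -[w]hsubmxK mul_row_col mulmxDl.
  set w1 := lsubmx w; set u := rsubmx w; exists ((u *m eps A) 0 0).
  have -> : (w1 *m dif B 0 *m eps B + u *m f 0 *m eps B) 0 0 - (u *m eps A) 0 0 * a
     = (w1 *m dif B 0 *m eps B) 0 0 - (a * (u *m eps A) 0 0 - (u *m f 0 *m eps B) 0 0).
    by rewrite mxE; ring.
  apply: hidealB => //; rewrite -mulmxA; apply: hideal_mulmx => // k l; rewrite ord1.
  exact: (dif_eps resB).
(* When the component in [A] is the boundary of [y], the vector [v + y *m f i.+1] is a cycle of [B],
   hence the boundary of some [z]. Then [row_mx z (- y)] bounds the whole cycle, the sign being that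
   of the cone differential. *)
have key i (v : 'rV_(rk B i.+1)) (u : 'rV_(rk A i)) :
    v *m dif B i + u *m f i = 0 -> (exists y, u = y *m dif A i) ->
    exists w, row_mx v u = w *m cone_dif i.+1.
  move=> vu [y uE]; move: vu; rewrite uE -mulmxA cf mulmxA -mulmxDl.
  case/(lift_dif resB) => z zE; exists (row_mx z (- y)) => /=.
  by rewrite mul_row_block -zE mulmx0 add0r !mulNmx mulmxN opprK addrK.
case=> [|i] v; rewrite -[v]hsubmxK; move: (lsubmx v) (rsubmx v) => {}v u /=.
  split=> [|[w ->]].
    rewrite mul_row_col => vu; apply: (key 0%N) => //.
    (* Injectivity of multiplication by [a] enters here: the element of R/I' represented by [u]
       vanishes, so [u] is a boundary. *)
    case: (resA) => _ _ _ h _; apply/h/colon.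
    have -> : a * (u *m eps A) 0 0 =
       (a * (u *m eps A) 0 0 - (u *m f 0 *m eps B) 0 0) + (u *m f 0 *m eps B) 0 0.
      by rewrite subrK.
    apply: (ID) => //; move/eqP: vu; rewrite addrC addr_eq0 => /eqP->.
    rewrite mulNmx mxE; apply: hidealN => //; rewrite -mulmxA.
    by apply: hideal_mulmx => // k l; rewrite ord1; apply: (dif_eps resB).
  rewrite -mulmxA mul_block_col (difK resB) mul0mx addr0 mulNmx cf subrr.
  by rewrite col_mx0 mulmx0.
split=> [|[w ->]].
  rewrite mul_row_block mulmx0 add0r -[0]row_mx0 => /eq_row_mx[vu /eqP].
  rewrite mulmxN oppr_eq0 => /eqP u0; apply: (key i.+1) => //.
  exact: (lift_dif resA).
rewrite -mulmxA mulmx_block (difK resB) !mulNmx cf !mulmxN (difK resA).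
by rewrite addrN !mulmx0 !mul0mx !oppr0 !addr0 block_mx0 mulmx0.
Qed.

End Cone.

(** * Squarefree monomial ideals described by supports, and Koszul complexes *)

Section SquarefreeIdeals.
Context (K : fieldType) (n : nat).
Local Notation P := {mpoly K[n]}.
Implicit Types (E : {set 'I_n} -> bool) (A B C : {set 'I_n}) (m : 'X_{1..n}).

Definition mset m : {set 'I_n} := [set i | m i != 0%N].

Definition setm C : 'X_{1..n} := [multinom (i \in C : nat) | i < n].

Definition xmon C : P := 'X_[setm C].

Definition upclosed E : Prop := forall A B, A \subset B -> E A -> E B.

(* The squarefree monomial ideal of the up-closed family [E] of supports. *)
Definition sqI E (p : P) : Prop := {in msupp p, forall m, E (mset m)}.

Lemma msetD m1 m2 : mset (m1 + m2)%MM = mset m1 :|: mset m2.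
Proof. by apply/setP => i; rewrite !inE mnmDE addn_eq0 negb_and. Qed.

Lemma mset_setm C : mset (setm C) = C.
Proof. by apply/setP => i; rewrite !inE mnmE; case: (i \in C). Qed.

Lemma mdeg_setm C : mdeg (setm C) = #|C|.
Proof.
rewrite mdegE -sum1_card [RHS]big_mkcond; apply: eq_bigr => i _.
by rewrite mnmE; case: (i \in C).
Qed.

Lemma setmK C m : C \subset mset m -> (m - setm C + setm C)%MM = m.
Proof.
move=> /subsetP Cm; apply: submK; apply/mnm_lepP => i; rewrite mnmE.
case iC: (i \in C) => //; have := Cm i iC.
by rewrite inE lt0n.
Qed.

Lemma homog_xmon C : homog_int (xmon C) #|C|.
Proof. by rewrite /= dhomogX; apply/eqP/mdeg_setm. Qed.

Lemma xmon_cst C : C != set0 -> (xmon C)@_0%MM = 0.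
Proof.
move=> C0; rewrite mcoeffX; case: eqP => // E; case/set0Pn: C0 => i.
by rewrite -(mset_setm C) E inE mnm0E.
Qed.

Lemma hideal_sqI E : upclosed E -> hideal (sqI E).
Proof.
move=> upE; split=> [m|p q hp hq m|a p hp m|z p hp m].
- by rewrite msupp0.
- by move/msuppD_le; rewrite mem_cat => /orP[/hp|/hq].
- case/msuppM_le/allpairsP => -[m1 m2] /= [_ /hp Em2 ->].
  by apply: upE Em2; rewrite msetD subsetUr.
by move/msupp_hcomp; apply: hp.
Qed.

Lemma sqI_X E m (c : K) : E (mset m) -> sqI E (c *: 'X_[m]).
Proof. by move=> Em m' /msuppZ_le; rewrite msuppX inE => /eqP->. Qed.

Lemma sqI_ext E E' p : E =1 E' -> sqI E p <-> sqI E' p.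
Proof. by move=> EE'; split=> h m /h; rewrite EE'. Qed.

(** Multiplying by a monomial translates exponents injectively, so nothing cancels, and it joins [C]
    to the support of each term. *)
Lemma sqI_colon E C p : sqI (fun A => E (A :|: C)) p <-> sqI E (xmon C * p).
Proof.
have memE m : (m \in msupp (xmon C * p)) = (m \in [seq (setm C + m')%MM | m' <- msupp p]).
  by rewrite mulrC (perm_mem (msuppMX _ _)).
split=> h m.
  by rewrite memE => /mapP[m' /h Em' ->]; rewrite msetD mset_setm setUC.
move=> mp; have := h (setm C + m)%MM; rewrite msetD mset_setm setUC; apply.
by rewrite memE; apply: map_f.
Qed.

Lemma sqI_add E C p : upclosed E ->
  sqI (fun A => E A || (C \subset A)) p <-> exists c, sqI E (p - c * xmon C).
Proof.
move=> upE; have hE := hideal_sqI upE; have [_ hD hM _] := hE.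
have upE' : upclosed (fun A => E A || (C \subset A)).
  move=> A B AB /orP[/(upE _ _ AB)->//|CA].
  by rewrite (subset_trans CA AB) orbT.
have [_ hD' hM' _] := hideal_sqI upE'; split=> [hp|[c hc]].
  (* The quotient collects the terms of [p] divisible by [xmon C]; every other term has its support
     in [E]. *)
  exists (\sum_(m <- msupp p | C \subset mset m) p@_m *: 'X_[m - setm C]).
  rewrite mulr_suml {1}[p]mpolyE (bigID (fun m => C \subset mset m)) /=.
  rewrite addrAC -sumrB [X in X + _]big1 ?add0r; last first.
    by move=> m Cm; rewrite -scalerAl -mpolyXD setmK // subrr.
  rewrite big_seq_cond; elim/big_ind: _ => [| |m /andP[mp Cm]] //.
    by case: hE.
  by apply: sqI_X; have := hp m mp; rewrite (negPf Cm) orbF.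
rewrite -(subrK (c * xmon C) p); apply: hD'; first by move=> m /hc->.
by apply: hM' => m; rewrite msuppX inE => /eqP->; rewrite mset_setm subxx orbT.
Qed.

Lemma is_gfres_quot_ext (I J : P -> Prop) F :
  (forall p, I p <-> J p) -> is_gfres_quot I F -> is_gfres_quot J F.
Proof.
move=> IJ [h1 h2 h3 h4 h5]; split=> // [p|v].
  by have [v /IJ] := h3 p; exists v.
by rewrite -h4; split=> /IJ.
Qed.

(** By [Tor_le], a bound on the regularity, certified by any resolution, minimal or not. *)
Definition res_le E (r : int) : Prop :=
  exists T, is_gfres_quot (sqI E) T /\ shifts_le T r.

Lemma res_le_ext E E' r : E =1 E' -> res_le E r -> res_le E' r.
Proof.
move=> EE' [T [resT hT]]; exists T; split=> //.
by apply: is_gfres_quot_ext resT => p; apply: sqI_ext.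
Qed.

Definition res0 : gfres K n :=
  @GFRes K n (fun i => if i is 0%N then 1%N else 0%N) (fun _ _ => 0) (fun _ => 0) 1%:M.

Lemma res0P : is_gfres_quot (sqI (fun _ => false)) res0.
Proof.
have s0 p : sqI (fun _ => false) p <-> p = 0.
  split=> [h|-> m]; last by rewrite msupp0.
  apply/eqP; rewrite -msupp_eq0; move: h; rewrite /sqI.
  by case: (msupp p) => // m s /(_ m (mem_head _ _)).
split.
- by move=> k; rewrite ord1 mxE; apply: homog_int1.
- by move=> i k; case: (k).
- move=> p; exists p%:M; apply/s0.
  by rewrite mulmx1 mxE eqxx mulr1n subrr.
- move=> v; rewrite mulmx1 s0; split=> [v0|[w ->]]; last by rewrite mulmx0 mxE.
  by exists 0; rewrite mul0mx; apply/matrixP => i j; rewrite !ord1 v0 mxE.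
move=> i v; have -> : v = 0 by apply/rowP; case.
by rewrite mul0mx; split=> // _; exists 0; rewrite mul0mx.
Qed.

Lemma res_le0 (r : int) : 0 <= r -> res_le (fun _ => false) r.
Proof.
by move=> r0; exists res0; split=> [|i k /=]; [apply: res0P|apply: addr_ge0].
Qed.

Lemma res_le_add E C (r s t : int) : upclosed E -> res_le E r ->
  res_le (fun A => E (A :|: C)) s -> r <= t -> s + #|C|%:Z - 1 <= t ->
  res_le (fun A => E A || (C \subset A)) t.
Proof.
move=> upE [B [resB hB]] [A [resA hA]] rt st.
have hE := hideal_sqI upE.
have [f [cf f0 hf]] := lift_chain hE resA resB (homog_xmon C)
   (fun p => proj1 (sqI_colon E C p)).
exists (cone #|C|%:Z f); split; last exact: shifts_le_cone hB hA rt st.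
apply: is_gfres_quot_ext (cone_res hE resB resA (sqI_colon E C) cf f0 hf) => p.
exact: iff_sym (sqI_add C p upE).
Qed.

(** The hypothesis on [E] says that the ideal equals its colon by [xmon C], so the cone of
    multiplication by [xmon C] on [T] itself is a resolution, minimal since [xmon C] has no constant
    term. [iota] includes [T] as a summand, and the last clause locates the generators of the
    shifted copy. *)
Lemma koszul_step E C T : upclosed E -> C != set0 ->
  (forall A, E (A :|: C) = E A) ->
  is_gfres_quot (sqI E) T -> minimal_res T ->
  exists T' (iota : forall i, 'M[P]_(rk T i, rk T' i)),
  [/\ is_gfres_quot (sqI (fun A => E A || (C \subset A))) T' /\ minimal_res T',
      chain_map iota /\ eps T = iota 0%N *m eps T',
      forall i (v : 'rV_(rk T i)), v *m cst_mx (iota i) = 0 -> v = 0 &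
      forall i k, exists k', sh T' i.+1 k' = sh T i k + #|C|%:Z].
Proof.
move=> upE C0 EC resT mT.
pose f i : 'M[P]_(rk T i, rk T i) := (xmon C)%:M.
have cf : chain_map f by move=> i; rewrite /f scalar_mxC.
pose iota i : 'M[P]_(rk T i, cone_rk T T i) :=
  match i with 0 => 1%:M | j.+1 => row_mx 1%:M 0 end.
have hE := hideal_sqI upE.
exists (cone #|C|%:Z f), iota; split.
- split.
    apply: (@is_gfres_quot_ext (fun p => exists c, sqI E (p - c * xmon C))).
      by move=> p; apply: iff_sym (sqI_add C p upE).
    apply: (@cone_res _ _ _ _ _ _ (sqI E) (sqI E)) => //.
    - by move=> p; rewrite -sqI_colon; apply: sqI_ext => A; rewrite EC.
    - by move=> k; rewrite mul_scalar_mx mxE subrr; case: hE.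
    move=> i k l; rewrite mxE; case: eqP => [->|_]; last exact: homog_int0.
    by rewrite addrAC subrr add0r; apply: homog_xmon.
  have fC i : cst_mx (f i) = 0.
    apply/matrixP => k l; rewrite !mxE; case: eqP => _; last exact: mcoeff0.
    exact: xmon_cst.
  have cstP a b (M : 'M[P]_(a, b)) : cst_mx M = 0 <-> forall k l, (M k l)@_0%MM = 0.
    split=> [h k l|h]; first by have /matrixP/(_ k l) := h; rewrite !mxE.
    by apply/matrixP => k l; rewrite !mxE.
  move=> i; apply/cstP => k l; case: i k l => [|i] k l /=.
    by rewrite mxE; case: splitP => k' _; move: k' l; apply/cstP.
  rewrite !mxE; case: splitP => k' _; rewrite mxE; case: splitP => l' _.
  + by move: k' l'; apply/cstP.
  + by rewrite mxE mcoeff0.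
  + by move: k' l'; apply/cstP.
  by move: k' l'; apply/cstP; rewrite cst_mxN mT oppr0.
- split; last by rewrite mul1mx.
  case=> [|i] /=; first by rewrite mulmx1 mul_row_col mul1mx mul0mx addr0.
  by rewrite mul_row_block mul_mx_row !mulmx0 mul1mx !mul0mx mulmx1 !addr0.
- case=> [|i] v /=; first by rewrite cst_mx1 mulmx1.
  have -> : cst_mx (row_mx 1%:M 0 : 'M[P]_(rk T i.+1, rk T i.+1 + rk T i)) = row_mx 1%:M 0.
    apply/matrixP => k l; rewrite !mxE; case: splitP => j _; rewrite !mxE ?mcoeff0 //.
    by case: eqP => _; rewrite ?mcoeff0 // mcoeff1 eqxx.
  rewrite mul_mx_row mulmx1 mulmx0 -[0 in RHS]row_mx0.
  by move/eq_row_mx=> [].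
move=> i k; exists (rshift (rk T i.+1) k) => /=.
by rewrite (unsplitK (inr k)).
Qed.

(** Disjointness keeps each new monomial a nonzerodivisor modulo those already added. The last
    clause follows one generator into the shifted copy at every step; [i'] comes with an equation to
    avoid casts between dependent types. *)
Lemma koszul_extend (s : seq {set 'I_n}) E T : upclosed E ->
  is_gfres_quot (sqI E) T -> minimal_res T ->
  (forall C, C \in s -> C != set0 /\ forall A, E (A :|: C) = E A) ->
  pairwise (fun C D => [disjoint C & D]) s ->
  exists T' (iota : forall i, 'M[P]_(rk T i, rk T' i)),
  [/\ is_gfres_quot (sqI (fun A => E A || has (fun C => C \subset A) s)) T' /\ minimal_res T',
      chain_map iota /\ eps T = iota 0%N *m eps T',
      forall i (v : 'rV_(rk T i)), v *m cst_mx (iota i) = 0 -> v = 0 &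
      forall i k, exists i' (k' : 'I_(rk T' i')), i' = (i + size s)%N /\
        sh T' i' k' = sh T i k + (\sum_(C <- s) #|C|)%:Z].
Proof.
elim: s E T => [|C s IH] E T upE resT mT hs dis.
  exists T, (fun i => 1%:M); split.
  - by split=> //; apply: is_gfres_quot_ext resT => p; apply: sqI_ext => A; rewrite orbF.
  - by split=> [i|]; rewrite ?mulmx1 ?mul1mx.
  - by move=> i v; rewrite cst_mx1 mulmx1.
  by move=> i k; exists i, k; rewrite addn0 big_nil addr0.
have [C0 EC] := hs C (mem_head _ _).
have [T1 [io1 [[res1 m1] [c1 e1] inj1 sh1]]] := koszul_step upE C0 EC resT mT.
move: dis; rewrite pairwise_cons => /andP[/allP disC dis].
have [|D Ds|//|T2 [io2 [[res2 m2] [c2 e2] inj2 sh2]]] := IH _ T1 _ res1 m1.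
- move=> A B AB /orP[/(upE _ _ AB)->//|CA].
  by rewrite (subset_trans CA AB) orbT.
- have [D0 ED] := hs D (mem_behead (s := C :: s) Ds); split=> // A; rewrite ED.
  congr (_ || _); apply/idP/idP => [|CA]; last by apply: subset_trans CA (subsetUl _ _).
  move/subsetP=> CAD; apply/subsetP => x xC; have := CAD x xC.
  by rewrite inE (disjointFr (disC D Ds) xC) orbF.
exists T2, (fun i => io1 i *m io2 i); split.
- split=> //; apply: is_gfres_quot_ext res2 => p; apply: sqI_ext => A.
  by rewrite -orbA.
- split=> [i|]; first by rewrite mulmxA c1 -!mulmxA c2.
  by rewrite -mulmxA -e2.
- by move=> i v; rewrite cst_mxM mulmxA => /inj2/inj1.
move=> i k; have [k1 hk1] := sh1 i k; have [i' [k' [i'E shE]]] := sh2 _ k1.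
exists i', k'; split; first by rewrite i'E addSnnS.
by rewrite shE hk1 big_cons PoszD addrA.
Qed.

End SquarefreeIdeals.

(** * Forests: leaves, colon ideals and induced matchings *)

Section Graphs.
Context (n : nat) (e : rel 'I_n).
Implicit Types (A W L : {set 'I_n}) (t : 'I_n * 'I_n * 'I_n).

Definition path_in A : bool := [exists t, is3path e t && (tverts t \subset A)].

(** Bounds the induced matching number of G[W]: inducedness concerns covered vertices only, so no
    subgraph has to be formed. *)
Definition match_in W (N : nat) : Prop := forall S, ind3match e S ->
  \bigcup_(t in S) tverts t \subset W -> (#|S| <= N)%N.

Lemma sub_tverts a b c A :
  (tverts (a, b, c) \subset A) = [&& a \in A, b \in A & c \in A].
Proof. by rewrite /= !subUset !sub1set andbA. Qed.

Lemma upclosed_path_in : upclosed path_in.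
Proof.
move=> A B AB /existsP[t /andP[et tA]]; apply/existsP; exists t.
by rewrite et (subset_trans tA AB).
Qed.

Hypothesis tree_e : is_tree e.

Let e_sym : ssrbool.symmetric e. Proof. by case: tree_e => -[]. Qed.
Let eirr : ssrbool.irreflexive e. Proof. by case: tree_e => -[]. Qed.

Let eneq a b : e a b -> a != b.
Proof. by apply: contraTneq => ->; rewrite eirr. Qed.

Lemma path_inP A : reflect
  (exists a b c, [/\ a \in A, b \in A, c \in A & [/\ e a b, e b c & a != c]])
  (path_in A).
Proof.
apply: (iffP existsP) => [[[[a b] c]]|[a [b [c [aA bA cA [ab bc ac]]]]]].
  rewrite sub_tverts => /andP[/and5P[_ _ ac ab bc] /and3P[aA bA cA]].
  by exists a, b, c.
exists (a, b, c); rewrite sub_tverts aA bA cA /= ac ab bc.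
by rewrite !eneq.
Qed.

(** If some edge but no leaf existed, every path in [W] would extend at its head: the head has a
    neighbour other than its successor, and one already on the path would close a cycle. This yields
    a path on [n + 2] distinct vertices. *)
Lemma leaf_exists W :
  (forall a b, a \in W -> b \in W -> ~~ e a b) \/
  exists a b, [/\ a \in W, b \in W, e a b & forall c, c \in W -> e a c -> c = b].
Proof.
case: (boolP [exists a, exists b,
    [&& a \in W, b \in W, e a b & [forall c in W, e a c ==> (c == b)]]]).
  case/existsP=> a /existsP[b /and4P[aW bW ab /forall_inP h]].
  right; exists a, b; split=> // c cW ac; apply/eqP.
  by have := h c cW; rewrite ac.
move=> noleaf; left=> a0 b0 a0W b0W; apply/negP => ab0.
have long k : exists x y s, [/\ uniq [:: x, y & s], path e x (y :: s),
    {subset [:: x, y & s] <= W} & size s = k].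
  elim: k => [|k [x [y [s [us ps sW sk]]]]].
    exists a0, b0, [::]; rewrite /= inE ab0 eneq //; split=> // z.
    by rewrite !inE => /orP[]/eqP->.
  have xy : e x y by case/andP: ps.
  have [z [zW xz zy]] : exists z, [/\ z \in W, e x z & z != y].
    move: noleaf; rewrite negb_exists => /forallP/(_ x).
    rewrite negb_exists => /forallP/(_ y); rewrite xy !sW ?inE ?eqxx ?orbT //=.
    rewrite negb_forall => /existsP[z]; rewrite !negb_imply => /and3P[zW xz zy].
    by exists z.
  case: (boolP (z \in s)) => zs; last first.
    exists z, x, (y :: s); split=> //=; last by rewrite sk.
    - by rewrite !inE negb_or eq_sym eneq // negb_or zy zs.
    - by rewrite e_sym xz.
    by move=> v; rewrite inE => /orP[/eqP->|/sW].
  case: tree_e => _ []; case/splitPr: zs us ps => p1 p2 us ps.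
  exists [:: x, y & rcons p1 z]; split; first by rewrite /= size_rcons.
    move: us; rewrite -cat_rcons -!cat_cons cat_uniq.
    by case/and3P.
  move: ps; rewrite -cat_rcons -cat_cons cat_path => /andP[ps _].
  by rewrite /cycle rcons_path ps /= last_rcons e_sym.
have [x [y [s [us _ _ sn]]]] := long n.
by have := max_card (mem [:: x, y & s]); rewrite (card_uniqP us) /= sn card_ord ltnNge leqnSn.
Qed.

(** The ideal generated by the variables in [L] and by I_3(G[W]). The induction runs over such
    ideals because taking colons produces variables. *)
Definition EW L W A : bool := ~~ [disjoint L & A] || path_in (A :&: W).

Lemma upclosed_EW L W : upclosed (EW L W).
Proof.
move=> A B AB /orP[h|h]; apply/orP; [left|right].
  by apply: contraNN h; apply: disjointWr.
by apply: upclosed_path_in h; apply: setSI.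
Qed.

Section Leaf.
Context (L W : {set 'I_n}) (a b : 'I_n).
Hypotheses (LW : [disjoint L & W]) (aW : a \in W) (bW : b \in W) (ab : e a b).
Hypothesis leaf : forall c, c \in W -> e a c -> c = b.

Let LWF x : x \in L -> x \in W -> False.
Proof. by move=> xL; rewrite (disjointFr LW xL). Qed.

(** The intermediate ideals between removing the leaf [a] and keeping it: [s] lists the [x] whose
    monomial a b x has been added. *)
Definition Eleaf (s : seq 'I_n) A : bool :=
  EW L (W :\ a) A || [&& a \in A, b \in A & has (mem A) s].

Lemma upclosed_Eleaf s : upclosed (Eleaf s).
Proof.
move=> A B AB /orP[h|/and3P[aA bA sA]]; apply/orP; [left|right].
  exact: upclosed_EW h.
rewrite !(subsetP AB) //=; apply: sub_has sA => x; exact: (subsetP AB).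
Qed.

Definition leaf_nbrs := [set x in W | e b x && (x != a)].

(** A 3-path through the leaf [a] has [a] at an end and [b] in the middle, since a middle vertex has
    two distinct neighbours. *)
Lemma Eleaf_nbrs : Eleaf (enum leaf_nbrs) =1 EW L W.
Proof.
move=> A; rewrite /Eleaf /EW -orbA; congr (_ || _); apply/idP/idP.
  case/orP=> [h|/and3P[aA bA /hasP[x]]].
    by apply: upclosed_path_in h; apply/setIS/subsetDl.
  rewrite mem_enum !inE => /and3P[xW bx xa] xA; apply/path_inP.
  by exists a, b, x; rewrite !inE aA bA aW bW xW xA eq_sym.
case/path_inP=> p [q [r []]]; rewrite !inE.
move=> /andP[pA pW] /andP[qA qW] /andP[rA rW] [pq qr pr].
have wedge x : e b x -> x \in A -> x \in W -> x != a -> a \in A -> b \in A ->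
    path_in (A :&: (W :\ a)) || [&& a \in A, b \in A & has (mem A) (enum leaf_nbrs)].
  move=> bx xA xW xa aA bA; rewrite aA bA orbC; apply/orP; left; apply/hasP; exists x => //.
  by rewrite mem_enum !inE xW bx xa.
case: (eqVneq q a) => [qa|qa].
  rewrite e_sym in pq; rewrite qa in pq qr.
  by move: pr; rewrite (leaf pW pq) (leaf rW qr) eqxx.
case: (eqVneq p a) => [pa|pa].
  rewrite pa in pq pr pA; have qb := leaf qW pq; rewrite qb in qr qA.
  by apply: (wedge r) => //; rewrite eq_sym.
case: (eqVneq r a) => [ra|ra].
  rewrite e_sym in qr; rewrite e_sym in pq.
  rewrite ra in qr pr rA; have qb := leaf qW qr; rewrite qb in pq qA.
  by apply: (wedge p).
apply/orP; left; apply/path_inP; exists p, q, r.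
by split=> //; rewrite !inE ?pA ?qA ?rA ?pa ?qa ?ra.
Qed.

Context (x : 'I_n).
Hypothesis xN : x \in leaf_nbrs.

Let C := tverts (a, b, x).
(** For [y] in [Nb] outside [C], one of y b x and b x y is a 3-path avoiding [a], so the colon by a
    b x contains the variable [y]. [Nb] also contains [a], [b] and [x]. *)
Let Nb := [set y in W | e b y || e x y].
Let L' := L :|: (Nb :\: C).
Let W' := (W :\: C) :\: Nb.

Let inC y : (y \in C) = [|| y == a, y == b | y == x].
Proof. by rewrite !inE orbA. Qed.

Let xE : [/\ x \in W, e b x, x != a & x != b].
Proof. by move: xN; rewrite inE => /and3P[xW bx xa]; rewrite xW bx xa eq_sym eneq. Qed.

Let ba : b != a. Proof. by rewrite eq_sym eneq. Qed.

Let CW y : y \in C -> y \in W.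
Proof. by have [xW _ _ _] := xE; rewrite inC => /or3P[]/eqP->. Qed.

Lemma Eleaf_colon s : {subset s <= leaf_nbrs} -> x \notin s ->
  (fun A => Eleaf s (A :|: C)) =1 EW L' W'.
Proof.
move=> sN xs A; have [xW bx xa xb] := xE; apply/idP/idP.
  have hit y : y \in A :|: C -> y \in L' -> EW L' W' A.
    rewrite in_setU => yAC yL'; apply/orP; left; apply/pred0Pn; exists y.
    rewrite /= yL' /=; case/orP: yAC => // yC; move: yL'.
    by rewrite !in_setU in_setD yC /= orbF => yL; case: (LWF yL (CW yC)).
  case/orP=> [/orP[/pred0Pn[y /andP[/= yL yA]]|]|].
  - by apply: (hit y) => //; rewrite in_setU yL.
  - case/path_inP=> p [q [r [pA qA rA [pq qr pr]]]].
    have K y : y \in (A :|: C) :&: (W :\ a) ->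
       EW L' W' A \/ [/\ y != a, y \in W, (y \in Nb) ==> (y \in C) & (y \in A) || (y \in C)].
      rewrite in_setI in_setD1 => /and3P[yAC ya yW].
      case: (boolP (y \in Nb :\: C)) => yN; [left|right].
        by apply: (hit y) => //; rewrite in_setU yN orbT.
      by move: yN; rewrite in_setD negb_and negbK implybE orbC; split=> //; rewrite -in_setU.
    case: (K p pA) => // -[pa pW pN pAC]; case: (K q qA) => // -[qa qW qN qAC].
    case: (K r rA) => // -[ra rW rN rAC].
    have Nb_of y z : z \in W -> y \in [:: b; x] -> e y z -> z \in Nb.
      by move=> zW; rewrite !inE zW => /orP[]/eqP-> ->; rewrite ?orbT.
    have two z : z != a -> z \in C -> z \in [:: b; x].
      by rewrite inC !inE => /negPf->.
    have qp : e q p by rewrite e_sym.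
    have rq : e r q by rewrite e_sym.
    (* If the middle vertex were [b] or [x], its neighbours [p] and [r] would lie in [Nb], hence in
       [C], and [b] and [x] would have to account for three distinct vertices. *)
    have qC : q \notin C.
      apply/negP => /(two _ qa) q2.
      have p2 := two _ pa (implyP pN (Nb_of _ _ pW q2 qp)).
      have r2 := two _ ra (implyP rN (Nb_of _ _ rW q2 qr)).
      move: q2 p2 r2 pr (eneq qp) (eneq qr); rewrite !inE.
      by do 3! [case/orP=> /eqP->]; rewrite ?eqxx.
    have qNb : q \notin Nb by apply: contra qC; apply/implyP.
    (* An end of the path in [C] would be [b] or [x] and would put [q] into [Nb]. *)
    have pC : p \notin C.
      by apply: contra qNb => /(two _ pa) p2; apply: Nb_of p2 pq.
    have rC : r \notin C.
      by apply: contra qNb => /(two _ ra) r2; apply: Nb_of r2 rq.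
    have pNb : p \notin Nb by apply: contra pC; apply/implyP.
    have rNb : r \notin Nb by apply: contra rC; apply/implyP.
    move: pAC qAC rAC; rewrite (negPf pC) (negPf qC) (negPf rC) !orbF => pA' qA' rA'.
    apply/orP; right; apply/path_inP; exists p, q, r; split=> //.
    + by rewrite in_setI pA' !in_setD pC pNb.
    + by rewrite in_setI qA' !in_setD qC qNb.
    by rewrite in_setI rA' !in_setD rC rNb.
  (* A monomial a b y with [y] in [s] contributes the variable [y], a neighbour of [b] distinct from
     [x]. *)
  case/and3P=> _ _ /hasP[y ys yA]; apply: (hit y) => //.
  have := sN y ys; rewrite inE => /and3P[yW yb ya].
  rewrite in_setU in_setD inC !inE yW yb (negPf ya) eq_sym (negPf (eneq yb)) /= andbT.
  by rewrite (memPn xs y ys) orbT.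
have mem y : y \in W -> y != a -> y \in A :|: C -> y \in (A :|: C) :&: (W :\ a).
  by move=> yW ya yA; rewrite in_setI yA in_setD1 ya.
have CA y : y \in C -> y \in A :|: C by move=> yC; rewrite in_setU yC orbT.
have AA y : y \in A -> y \in A :|: C by move=> yA; rewrite in_setU yA.
have bC : b \in C by rewrite inC eqxx orbT.
have xC : x \in C by rewrite inC eqxx !orbT.
case/orP=> [/pred0Pn[y /andP[/= yL yA]]|].
  move: yL; rewrite in_setU => /orP[yL|].
    do 2! [apply/orP; left]; apply/pred0Pn; exists y.
    by rewrite /= yL AA.
  rewrite in_setD inC !negb_or inE => /andP[/and3P[ya yb yx] /andP[yW byx]].
  apply/orP; left; apply/orP; right; apply/path_inP.
  case/orP: byx => [by_|xy].
    exists y, b, x; split; [exact/mem/AA|exact/mem/CA|exact/mem/CA|].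
    by rewrite e_sym.
  exists b, x, y; split; [exact/mem/CA|exact/mem/CA|exact/mem/AA|].
  by rewrite eq_sym.
move=> h; apply/orP; left; apply/orP; right; apply: upclosed_path_in h.
apply/subsetP => y; rewrite in_setI !in_setD => /and4P[yA _ yC yW].
apply: mem => //; last exact: AA.
by move: yC; rewrite inC; case: eqP.
Qed.

Lemma disjoint_colon : [disjoint L' & W'].
Proof.
apply/pred0P => y; rewrite /= in_setU !in_setD.
apply/negbTE/negP => /andP[/orP[yL /and3P[_ _ /(LWF yL)]|]] //.
by case/andP=> _ ->.
Qed.

Lemma card_colon : (#|W'| < #|W|)%N.
Proof.
apply: proper_card; apply/properP; split.
  by apply/subsetP => y; rewrite !in_setD => /and3P[].
by exists a => //; rewrite !in_setD inC eqxx andbF.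
Qed.

(** The path [(a, b, x)] can join any induced matching inside [W'], even the empty one: the leaf [a]
    has no neighbour in [W] but [b], and [W'] omits the neighbours of [b] and [x]. *)
Lemma match_in_colon N : match_in W N -> (0 < N)%N /\ match_in W' N.-1.
Proof.
move=> mW; have [xW bx xa xb] := xE.
have ext S : ind3match e S -> \bigcup_(t in S) tverts t \subset W' -> (#|S| < N)%N.
  move=> /and3P[/forall_inP pS /forall_inP dS /forallP eS] SW'.
  have W'C y : y \in W' -> y \notin C by rewrite !in_setD => /and3P[].
  have SW t y : t \in S -> y \in tverts t -> y \in W'.
    by move=> tS yt; apply: (subsetP SW'); apply/bigcupP; exists t.
  have t0S : (a, b, x) \notin S.
    have aC : a \in C by rewrite inC eqxx.
    by apply/negP => /SW/(_ aC)/W'C; rewrite aC.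
  have -> : (#|S|.+1 = #|(a, b, x) |: S|)%N by rewrite cardsU1 t0S.
  have far u v : u \in W' -> v \in C -> ~~ e v u.
    rewrite !in_setD !inC => /and3P[uN]; rewrite !negb_or => /and3P[ua ub ux] uW.
    case/or3P=> /eqP->.
    - by apply: contra ub => /(leaf uW) ->.
    - by apply: contra uN => bu; rewrite inE uW bu.
    by apply: contra uN => xu; rewrite inE uW xu orbT.
  apply: mW; last first.
    apply/bigcupsP => t; rewrite in_setU1 => /orP[/eqP->|tS].
      by apply/subsetP => y /CW.
    by apply/subsetP => y /(SW _ _ tS); rewrite !in_setD => /and3P[].
  have dS0 t : t \in S -> [disjoint tverts t & C].
    move=> tS; apply/pred0P => y /=; apply/negbTE/negP => /andP[/(SW _ _ tS)/W'C].
    by move/negPf->.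
  apply/and3P; split.
  - apply/forall_inP => t; rewrite in_setU1 => /orP[/eqP->|]; last exact: pS.
    by rewrite /= ab bx (eneq ab) (eneq bx) eq_sym xa.
  - apply/forall_inP => t ht; apply/forall_inP => t' ht'; apply/implyP.
    move: ht ht'; rewrite !in_setU1 => /orP[/eqP->|tS] /orP[/eqP->|t'S] //.
    + by rewrite eqxx.
    + by move=> _; rewrite disjoint_sym; apply: dS0.
    + by move=> _; apply: dS0.
    by apply/implyP; apply: (forall_inP (dS t tS)).
  apply/forallP => u; apply/forallP => v; apply/implyP.
  have cov y : y \in \bigcup_(t in (a, b, x) |: S) tverts t ->
      y \in C \/ (y \in \bigcup_(t in S) tverts t) /\ y \in W'.
    case/bigcupP=> t; rewrite in_setU1 => /orP[/eqP->|tS] yt; [left|right] => //.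
    by split; [apply/bigcupP; exists t|apply: SW yt].
  case/and3P=> /cov[uC|[uS uW]] /cov[vC|[vS vW]] uv.
  - apply/exists_inP; exists (a, b, x); first by rewrite in_setU1 eqxx.
    (* The path is itself induced: a chord would give the leaf [a] a second neighbour. *)
    have nax : ~~ e a x by apply/negP => /(leaf xW) xbE; rewrite xbE eqxx in xb.
    move: uC vC uv; rewrite !inC => /or3P[]/eqP-> /or3P[]/eqP->;
      rewrite ?eirr ?(negPf nax) ?(e_sym x a) ?(negPf nax) //= ?eqxx ?orbT //.
  - by have := far v u vW uC; rewrite uv.
  - by have := far u v uW vC; rewrite e_sym uv.
  have := forallP (eS u) v; rewrite uS vS uv => /exists_inP[t tS tuv].
  by apply/exists_inP; exists t => //; rewrite in_setU1 tS orbT.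
have N0 : (0 < N)%N.
  apply: leq_ltn_trans (ext set0 _ _) => //; last by rewrite big_set0 sub0set.
  apply/and3P; split; try by apply/forall_inP => t; rewrite inE.
  by apply/forallP => u; apply/forallP => v; rewrite big_set0 !inE.
by split=> // S mS SW; rewrite -ltnS prednK //; apply: ext.
Qed.

End Leaf.

(** * Upper bound by induction on the number of vertices *)

Section Bound.
Context (K : fieldType).

(** A variable raises degree and homological degree by one each, so the bound is unchanged. *)
Lemma res_le_vars (s : seq 'I_n) (r : int) : 0 <= r ->
  @res_le K n (fun A => has (mem A) s) r.
Proof.
move=> r0; elim: s => [|x s IH]; first exact: res_le0.
have up : upclosed (fun A : {set 'I_n} => has (mem A) s).
  by move=> A B AB; apply: sub_has => y; apply: (subsetP AB).
have [xs|xs] := boolP (x \in s).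
  apply: res_le_ext IH => A /=; case: (boolP (x \in A)) => //= xA.
  by apply/hasP; exists x.
apply: (@res_le_ext _ _ (fun A => has (mem A) s || ([set x] \subset A))).
  by move=> A; rewrite sub1set orbC.
apply: (res_le_add (s := r) up IH) => //; last by rewrite cards1; lia.
apply: res_le_ext IH => A; apply: eq_in_has => y ys.
rewrite -[LHS]/(y \in A) -[RHS]/(y \in A :|: [set x]) !inE.
case: (eqVneq y x) => [yx|_]; last by rewrite orbF.
by rewrite -yx ys in xs.
Qed.

Lemma res_le_edgeless L W (r : int) : 0 <= r ->
  (forall a b, a \in W -> b \in W -> ~~ e a b) -> @res_le K n (EW L W) r.
Proof.
move=> r0 noe; apply: res_le_ext (res_le_vars (enum L) r0) => A; rewrite /EW.
have -> : path_in (A :&: W) = false.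
  apply/negbTE/negP => /path_inP[a [b [c [/setIP[_ aW] /setIP[_ bW] _ [ab _ _]]]]].
  by rewrite (negPf (noe a b aW bW)) in ab.
rewrite orbF; apply/hasP/pred0Pn => [[y]|[y /andP[yL yA]]].
  by rewrite mem_enum => yL yA; exists y; rewrite /= yL.
by exists y; rewrite ?mem_enum.
Qed.

Lemma res_le_forest k L W (N : nat) : (#|W| <= k)%N -> [disjoint L & W] ->
  match_in W N -> @res_le K n (EW L W) (2 * N)%:Z.
Proof.
elim: k L W N => [|k IH] L W N Wk LW mW; case: (leaf_exists W) => [noe|].
- exact: (res_le_edgeless _ _ noe).
- case=> a [b [aW _ _ _]]; move: Wk.
  by rewrite leqn0 cards_eq0 => /eqP W0; rewrite W0 inE in aW.
- exact: (res_le_edgeless _ _ noe).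
case=> a [b [aW bW ab leaf]].
apply: (res_le_ext (Eleaf_nbrs L aW bW ab leaf)).
have : {subset enum (leaf_nbrs W a b) <= leaf_nbrs W a b} by move=> y; rewrite mem_enum.
(* Inner induction adding the monomials a b x one at a time, starting from the forest without
   [a]. *)
elim: (enum _) (enum_uniq (leaf_nbrs W a b)) => [_ _|x s IHs /= /andP[xs us] sN].
  apply: (@res_le_ext _ _ (EW L (W :\ a))); first by move=> A; rewrite /Eleaf !andbF orbF.
  apply: IH.
  - by rewrite (cardsD1 a W) aW in Wk.
  - by apply: disjointWr LW; apply: subsetDl.
  by move=> S mS SW; apply: mW => //; apply: subset_trans SW (subsetDl _ _).
have xN : x \in leaf_nbrs W a b by apply: sN; rewrite inE eqxx.
have [N0 mW'] := match_in_colon aW bW ab leaf xN mW.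
have sN' : {subset s <= leaf_nbrs W a b} by move=> y ys; apply: sN; rewrite inE ys orbT.
apply: (@res_le_ext _ _ (fun A => Eleaf L W a b s A || (tverts (a, b, x) \subset A))).
  move=> A; rewrite sub_tverts /Eleaf /= -orbA; congr (_ || _).
  by case: (a \in A); case: (b \in A); rewrite //= orbC.
apply: (@res_le_add _ _ (Eleaf L W a b s) (tverts (a, b, x)) _ (2 * N.-1)%:Z _ _
  (IHs us sN')) => //.
- exact: upclosed_Eleaf.
- apply: (res_le_ext (fun A => esym (Eleaf_colon LW aW bW ab xN sN' xs A))).
  apply: IH mW'; last exact: disjoint_colon.
  by rewrite -ltnS; apply: leq_trans Wk; apply: card_colon.
have -> : #|tverts (a, b, x)| = 3%N.
  move: xN; rewrite inE => /and3P[_ bx xa].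
  by rewrite /= -setUA cardsU1 cards2 !inE negb_or (eneq ab) (eneq bx) eq_sym xa.
(* The count is exact: [2 * N.-1 + 3 - 1 = 2 * N], as [N] is positive. *)
by lia.
Qed.

End Bound.

End Graphs.

(** * The 3-path ideal as a squarefree monomial ideal *)

Lemma mon3E (K : fieldType) (n : nat) (e : rel 'I_n) t :
  is3path e t -> mon3 K t = xmon K (tverts t).
Proof.
case: t => [[a b] c] /and5P[ab bc ac _ _]; rewrite /mon3 /xmon -!mpolyXD.
congr 'X_[_]; apply/mnmP => i; rewrite !mnmDE !mnm1E mnmE !inE !(eq_sym _ i).
case: (eqVneq i a) => [->|_]; first by rewrite (negPf ab) (negPf ac).
case: (eqVneq i b) => [->|_]; first by rewrite (negPf bc).
by case: (i == c).
Qed.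

Lemma in_I3E (K : fieldType) (n : nat) (e : rel 'I_n) (p : {mpoly K[n]}) :
  sqI (path_in e) p <-> in_I3 e p.
Proof.
have [h0 hD hM _] := hideal_sqI K (@upclosed_path_in n e).
split=> [hp|[q ->]].
  have D (f g : {mpoly K[n]}) : in_I3 e f -> in_I3 e g -> in_I3 e (f + g).
    case=> qf -> [qg ->]; exists (fun t => qf t + qg t).
    by rewrite -big_split; apply: eq_bigr => t _; rewrite mulrDl.
  rewrite [p]mpolyE big_seq; elim/big_ind: _ => [|//|m mp].
    by exists (fun _ => 0); rewrite big1 // => t _; rewrite mul0r.
  have /existsP[t /andP[et tm]] := hp m mp.
  (* The whole term at [m] is charged to one path [t] whose monomial divides it. *)
  exists (fun t' => if t' == t then p@_m *: 'X_[m - setm (tverts t)] else 0).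
  rewrite (bigD1 t) //= eqxx big1 => [|t' /andP[_ /negPf->]]; last by rewrite mul0r.
  by rewrite addr0 (mon3E K et) -scalerAl -mpolyXD setmK.
apply: big_ind => // t et; apply: hM => m.
rewrite (mon3E K et) msuppX inE => /eqP->; rewrite mset_setm.
by apply/existsP; exists t; rewrite et subxx.
Qed.

(** * Lower bound from an induced matching *)

Section MaximalMatching.
Context (n : nat) (e : rel 'I_n) (S : {set 'I_n * 'I_n * 'I_n}).
Hypothesis mS : ind3match e S.

Let U : {set 'I_n} := \bigcup_(t in S) tverts t.
(** [gens] gives the complete intersection J, and [gens] together with [vars] gives J'. *)
Let gens := [seq tverts t | t <- enum S].
Let vars := [seq [set v] | v <- enum (~: U)].

Lemma has_gens (A : {set 'I_n}) :
  has (fun C : {set 'I_n} => C \subset A) gens = [exists t in S, tverts t \subset A].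
Proof.
rewrite has_map; apply/hasP/exists_inP => [[t tS tA]|[t tS tA]]; exists t => //.
  by rewrite mem_enum in tS.
by rewrite mem_enum.
Qed.

Lemma gens_path_in (A : {set 'I_n}) :
  has (fun C : {set 'I_n} => C \subset A) gens -> path_in e A.
Proof.
rewrite has_gens => /exists_inP[t tS tA]; apply/existsP; exists t; rewrite tA andbT.
by case/and3P: mS => /forall_inP h _ _; apply: h.
Qed.

(** A vertex of the path outside [U] gives a variable. Otherwise inducedness puts both edges on
    paths of [S]; these share the middle vertex, so by disjointness they are one path, with the same
    three vertices. *)
Lemma path_in_gens_vars (A : {set 'I_n}) : path_in e A ->
  has (fun C : {set 'I_n} => C \subset A) gens || has (fun C : {set 'I_n} => C \subset A) vars.
Proof.
case/existsP=> -[[a b] c]; rewrite sub_tverts.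
case/andP=> /and5P[ab bc ac eab ebc] /and3P[aA bA cA].
have out x : x \in A -> x \notin U -> has (fun C : {set 'I_n} => C \subset A) vars.
  move=> xA xU; rewrite has_map; apply/hasP; exists x; rewrite ?mem_enum ?inE //=.
  by rewrite sub1set.
case: (boolP (a \in U)) => [aU|/(out a aA)->]; last by rewrite orbT.
case: (boolP (b \in U)) => [bU|/(out b bA)->]; last by rewrite orbT.
case: (boolP (c \in U)) => [cU|/(out c cA)->]; last by rewrite orbT.
case/and3P: mS => _ /forall_inP dS /forallP eS.
have /exists_inP[t tS tab] : [exists t in S, path_edge t a b].
  by have := forallP (eS a) b; rewrite aU bU eab.
have /exists_inP[t' tS' tbc] : [exists t in S, path_edge t b c].
  by have := forallP (eS b) c; rewrite bU cU ebc.
have pe (s : 'I_n * 'I_n * 'I_n) u v : path_edge s u v -> (u \in tverts s) && (v \in tverts s).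
  case: s => [[p q] r] /=; rewrite !inE.
  by case/or3P=> [|| /orP[]] /andP[/eqP-> /eqP->]; rewrite !eqxx ?orbT.
have tt' : t' = t.
  apply/eqP; apply: contraT => ne; have := implyP (forall_inP (dS t' tS') t tS) ne.
  have /andP[_ bt] := pe _ _ _ tab; have /andP[bt' _] := pe _ _ _ tbc.
  by move/disjointFr/(_ bt'); rewrite bt.
rewrite {}tt' {tS'} in tbc.
apply/orP; left; rewrite has_gens; apply/exists_inP; exists t => //.
case: t {tS} tab tbc => [[p q] r]; rewrite sub_tverts /=.
case/or3P=> [|| /orP[]] /andP[/eqP<- /eqP<-];
  case/or3P=> [|| /orP[]] /andP[/eqP E1 /eqP E2]; subst;
  rewrite ?eqxx ?aA ?bA ?cA // in ab bc ac *.
Qed.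

Lemma sum_card_gens : (\sum_(C <- gens) #|C| = 3 * #|S|)%N.
Proof.
rewrite big_map big_enum /= (eq_bigr (fun _ => 3%N)) ?sum_nat_const ?(mulnC #|S|) //.
case/and3P: mS => /forall_inP pS _ _ => -[[a b] c] /pS /and5P[ab bc ac _ _].
by rewrite /= -setUA cardsU1 cards2 !inE negb_or ab bc ac.
Qed.

Lemma Tor_matching (K : fieldType) (F : gfres K n) :
  is_gfres_quot (sqI (path_in e)) F -> Tor_nonzero F #|S| (3 * #|S|)%N%:Z.
Proof.
move=> resF; case/and3P: (mS) => /forall_inP pS /forall_inP dS _.
have m0 : minimal_res (res0 K n).
  by move=> i; apply/matrixP => k l; rewrite !mxE mcoeff0.
pose E0 (A : {set 'I_n}) := false.
have up0 : upclosed E0 by [].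
have [||T [_ [[resT mT] _ _ shT]]] := koszul_extend (s := gens) up0 (res0P K n) m0.
- move=> C /mapP[t tS ->]; split=> //; case: t {tS} => [[a b] c].
  by apply/set0Pn; exists a; rewrite !inE eqxx.
- rewrite pairwise_map; have: {subset enum S <= S} by move=> t; rewrite mem_enum.
  elim: (enum S) (enum_uniq S) => //= t s IH /andP[ts us] sS.
  rewrite IH // ?andbT => [|t' ts']; last by apply: sS; rewrite inE ts' orbT.
  apply/allP => t' ts'; have tt' : t != t' by apply: contraNneq ts => ->.
  apply: implyP tt'; apply: (forall_inP (dS t _)); apply: sS.
    by rewrite inE eqxx.
  by rewrite inE ts' orbT.
pose E1 (A : {set 'I_n}) := E0 A || has (fun C : {set 'I_n} => C \subset A) gens.
have up1 : upclosed E1.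
  move=> A B AB; rewrite /E1 /=; apply: sub_has => C CA; exact: subset_trans AB.
(* Variables outside [U] divide no generator of J, so the Koszul construction continues with
   them. *)
have [||T' [iota [[resT' mT'] [ci i0] inj _]]] := koszul_extend (s := vars) up1 resT mT.
- move=> C /mapP[v]; rewrite mem_enum inE => vU ->; split=> [|A].
    by apply/set0Pn; exists v; rewrite inE.
  rewrite /E1 /= !has_gens; apply: eq_existsb => t; case tS: (t \in S) => //=.
  apply/idP/idP => [/subsetP h|h]; last by apply: subset_trans h (subsetUl _ _).
  apply/subsetP => y yt; have := h y yt; rewrite !inE => /orP[//|/eqP yv].
  by case/bigcupP: vU; exists t; rewrite -?yv.
- rewrite pairwise_map; elim: (enum (~: U)) (enum_uniq (~: U)) => //= v s IH /andP[vs us].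
  rewrite IH // andbT; apply/allP => w ws.
  by rewrite /= disjoints1 inE; apply: contraNneq vs => ->.
(* The single generator of [res0], of degree 0, has moved to position [#|S|] and degree
   [3 * #|S|]. *)
have [i [k [iE shk]]] := shT 0%N ord0.
rewrite add0n size_map -cardE in iE; subst i.
rewrite /= add0r sum_card_gens in shk; rewrite -shk.
have upI := @upclosed_path_in n e.
apply: (Tor_ge _ _ _ _ _ resF resT resT' mT mT' ci i0 (inj _)).
- exact: hideal_sqI.
- apply: hideal_sqI => A B AB; rewrite /E1 /= => /orP[h|h]; apply/orP; [left|right];
    apply: sub_has h => C CA; exact: subset_trans AB.
- by move=> p h m /h; apply: gens_path_in.
by move=> p h m /h; apply: path_in_gens_vars.
Qed.

End MaximalMatching.

Theorem theorem4p4 (K : fieldType) (n : nat) (e : rel 'I_n) :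
  is_tree e ->
  reg_eq (@in_I3 K n e) (2 * nu3 e)%:Z.
Proof.
move=> tree_e.
have mW : match_in e [set: 'I_n] (nu3 e).
  by move=> S mS _; apply: (leq_bigmax_cond (F := fun S : {set _} => #|S|)).
have [T [resT hT]] : @res_le K n (path_in e) (2 * nu3 e)%:Z.
  (* The whole forest is the case with no variable adjoined. *)
  apply: (@res_le_ext _ _ (EW e set0 [set: 'I_n])).
    by move=> A; rewrite /EW setIT -setI_eq0 set0I eqxx.
  by apply: (@res_le_forest n e tree_e K n set0 setT (nu3 e) _ _ mW);
    rewrite ?cardsT ?card_ord // -setI_eq0 set0I.
split; first by exists T; apply: is_gfres_quot_ext resT => p; apply: in_I3E.
move=> F /(is_gfres_quot_ext (fun p => iff_sym (in_I3E e p))) resF; split.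
  have [S mS ->] : {S | ind3match e S & nu3 e = #|S|}.
    (* The maximum is attained because the empty matching makes its range nonempty. *)
    have [|S mS SE] := @eq_bigmax_cond _ (ind3match e) (fun S : {set _} => #|S|).
      apply/card_gt0P; exists set0; apply/and3P; split.
      - by apply/forall_inP => t; rewrite inE.
      - by apply/forall_inP => t; rewrite inE.
      by apply/forallP => u; apply/forallP => v; rewrite big_set0 !inE.
    by exists S.
  exists #|S|, (3 * #|S|)%N%:Z; split; last by lia.
  exact: (Tor_matching mS resF).
by move=> i j; apply: Tor_le resT hT => //; apply/hideal_sqI/upclosed_path_in.
Qed.
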